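(* Let $G$ be a connected graph of order $n\geq 4$. Then $\chi_d^t(C(G))=n+\lceil n/2\rceil$ if and only if $G$ is isomorphic to the complete graph $K_n$.
   Context: All graphs are finite, simple and undirected. For a graph $G=(V,E)$ with $V=\{v_1,\dots,v_n\}$, the central graph $C(G)$ is the graph with vertex set $V\cup\{c_{ij} : v_iv_j\in E\}$ obtained by subdividing each edge $v_iv_j$ of $G$ exactly once by a new vertex $c_{ij}$ (adjacent to exactly $v_i$ and $v_j$) and joining every pair of distinct vertices non-adjacent in $G$. A total dominator coloring (TDC) of a graph $H$ with no isolated vertices is a proper vertex coloring of $H$ in which every vertex is adjacent to all vertices of some color class. $\chi_d^t(H)$ is the minimum number of color classes in a TDC of $H$. *)

(* Defs.v *)
From mathcomp Require Import all_boot.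

Set Implicit Arguments.
Unset Strict Implicit.
Unset Printing Implicit Defensive.

Record sgraph := SGraph {
  vertex :> finType;
  adj : rel vertex;
  adj_sym : symmetric adj;
  adj_irrefl : irreflexive adj
}.

Arguments adj {s}.

Definition connected (G : sgraph) : Prop := forall x y : G, connect adj x y.

Definition graph_iso (G H : sgraph) : Prop :=
  exists2 f : G -> H, bijective f & forall x y : G, adj (f x) (f y) = adj x y.

Section Complete.

Variable n : nat.

Definition complete_adj : rel 'I_n := fun i j => i != j.

Lemma complete_adj_sym : symmetric complete_adj.
Proof. by move=> i j; rewrite /complete_adj eq_sym. Qed.

Lemma complete_adj_irrefl : irreflexive complete_adj.
Proof. by move=> i; rewrite /complete_adj eqxx. Qed.

Definition complete_graph : sgraph := SGraph complete_adj_sym complete_adj_irrefl.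

End Complete.

Section Central.

Variable G : sgraph.

Definition is_edge (A : {set G}) : bool :=
  [exists x : G, exists y : G, adj x y && (A == [set x; y])].

Definition edge : finType := {A : {set G} | is_edge A}.

(* [inr A] is the vertex subdividing the edge [A]. *)
Definition central_adj : rel (G + edge)%type := fun p q =>
  match p, q with
  | inl x, inl y => (x != y) && ~~ adj x y
  | inl x, inr A => x \in val A
  | inr A, inl x => x \in val A
  | inr _, inr _ => false
  end.

Lemma central_adj_sym : symmetric central_adj.
Proof. by move=> [x|A] [y|B] //=; rewrite eq_sym adj_sym. Qed.

Lemma central_adj_irrefl : irreflexive central_adj.
Proof. by move=> [x|A] //=; rewrite eqxx. Qed.

Definition central_graph : sgraph := SGraph central_adj_sym central_adj_irrefl.

End Central.

Section TotalDominatorColoring.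

Variable H : sgraph.

Definition no_isolated : Prop := forall x : H, exists y : H, adj x y.

Definition color_class k (f : {ffun H -> 'I_k}) (i : 'I_k) : {set H} :=
  [set x | f x == i].

Definition proper_coloring k (f : {ffun H -> 'I_k}) : bool :=
  [forall x : H, forall y : H, adj x y ==> (f x != f y)].

(* Colour classes are nonempty: the dominated class must be that of a colour
   actually used by [f]. *)
Definition is_tdc k (f : {ffun H -> 'I_k}) : bool :=
  proper_coloring f &&
  [forall x : H, exists i : 'I_k,
     (color_class f i != set0) && (color_class f i \subset [set y | adj x y])].

(* All [k] colours are used, so that the coloring has exactly [k] classes. *)
Definition has_tdc (k : nat) : bool :=
  [exists f : {ffun H -> 'I_k},
     is_tdc f && [forall i : 'I_k, color_class f i != set0]].

(* A coloring has at most [#|H|] classes, so minimising over ['I_#|H|.+1] loses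
   nothing. The value is only meaningful when [H] has no isolated vertex; see
   [tdc_numberP]. *)
Definition tdc_number : nat :=
  [arg min_(k < (ord_max : 'I_#|H|.+1) | has_tdc k) (k : nat)].

Lemma has_tdc_card : no_isolated -> has_tdc #|H|.
Proof.
move=> isoH; apply/existsP; exists [ffun x => enum_rank x].
apply/andP; split; last first.
  apply/forallP=> i; apply/set0Pn; exists (enum_val i).
  by rewrite inE ffunE enum_valK.
apply/andP; split.
  apply/forallP=> x; apply/forallP=> y; apply/implyP=> xy.
  rewrite !ffunE; apply: contraTneq xy => /enum_rank_inj ->.
  by rewrite adj_irrefl.
apply/forallP=> x; have [y xy] := isoH x; apply/existsP; exists (enum_rank y).
apply/andP; split; first by apply/set0Pn; exists y; rewrite inE ffunE.
by apply/subsetP=> z; rewrite !inE ffunE => /eqP/enum_rank_inj ->.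
Qed.

Lemma has_tdc_leq k : has_tdc k -> k <= #|H|.
Proof.
case/existsP=> f /andP[_ /forallP surj].
rewrite -[k]card_ord; apply: leq_trans (leq_image_card f H).
apply/subset_leq_card/subsetP=> i _; have /set0Pn[x] := surj i.
by rewrite inE => /eqP <-; apply: image_f.
Qed.

Lemma tdc_numberP : no_isolated ->
  has_tdc tdc_number /\ forall k, has_tdc k -> tdc_number <= k.
Proof.
move=> isoH; rewrite /tdc_number; case: arg_minnP => [|m tm minm].
  exact: has_tdc_card.
split=> // k tk; have lek : k < #|H|.+1 by rewrite ltnS has_tdc_leq.
exact: (minm (Ordinal lek)).
Qed.

End TotalDominatorColoring.

Lemma central_no_isolated (G : sgraph) :
  1 < #|G| -> no_isolated (central_graph G).
Proof.
move=> G2 [x|[A eA]]; last first.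
  have /existsP[x /existsP[y /andP[_ /eqP defA]]] := eA.
  by exists (inl x); rewrite /= defA !inE eqxx.
have [y yx] : exists y : G, y != x.
  apply/existsP; apply: contraLR G2 => /existsPn all_x; rewrite -leqNgt.
  by rewrite -(card1 x); apply/subset_leq_card/subsetP=> y _; move: (all_x y);
     rewrite negbK inE.
have [xy|nxy] := boolP (adj x y); last by exists (inl y); rewrite /= eq_sym yx.
have eA : is_edge [set x; y].
  by apply/existsP; exists x; apply/existsP; exists y; rewrite xy eqxx.
by exists (inr (Sub [set x; y] eA : edge G)); rewrite /= !inE eqxx.
Qed.

(* Main.v *)
Require Import Defs.
From mathcomp Require Import all_boot.
From mathcomp Require Import zify.

Set Implicit Arguments.
Unset Strict Implicit.
Unset Printing Implicit Defensive.

(** A vertex of [G] with a non-neighbour is dominated in [C(G)] by that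
    non-neighbour as soon as the latter is alone in its class, so only the set
    [U] of universal vertices costs edge colours.  If [2 <= #|U|], give two
    universal vertices a common colour, let every other vertex be a singleton
    class, cover [U] by [uphalf #|U|] edges that are singleton classes, and put
    the remaining edges into one class; this is [n + uphalf #|U|] colours, and
    [#|U| <= n - 2] unless [G] is complete.  If [#|U| <= 1], [n + 1] colours
    suffice.

    Conversely let [G] be complete.  A class dominated by a vertex [v] consists
    of edges at [v], so it serves at most two vertices, and it is a
    single edge if it serves two.  Thus at least [uphalf n] classes avoid [V].  If the vertices use
    [n] colours we are done.  Otherwise two vertices share a colour, which forces
    [n - 1] vertex colours that occur on no edge; were there only [uphalf n]
    other colours, all but one of them would be singletons, and the exceptional
    one would lie in a star at some [w], which is impossible for the edges of a
    triangle avoiding [w]. *)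

(** Restricting the colour type to the image of [f] makes every colour used, so colourings can take
    values in any convenient finite type. *)
Lemma tdc_number_leq (H : sgraph) (T : finType) (f : H -> T) :
    (forall x y, adj x y -> f x != f y) ->
    (forall x, exists y, forall z, f z = f y -> adj x z) ->
  tdc_number H <= #|T|.
Proof.
move=> prf domf; pose T' : finType := {t : T | t \in codom f}.
pose s x : T' := Sub (f x) (codom_f f x).
have eq_s x y : (enum_rank (s x) == enum_rank (s y)) = (f x == f y).
  by rewrite (inj_eq enum_rank_inj) -val_eqE.
have isoH : no_isolated H by move=> x; have [y dy] := domf x; exists y; apply: dy.
have [_ minH] := tdc_numberP isoH.
apply: (@leq_trans #|T'|); last by rewrite card_sig max_card.
apply: minH; apply/existsP; exists [ffun x => enum_rank (s x)].
apply/andP; split; last first.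
  apply/forallP=> i; apply/set0Pn.
  have /codomP[x fx] := valP (enum_val i); exists x; rewrite inE ffunE.
  apply/eqP; rewrite -[RHS]enum_valK; congr enum_rank.
  by apply: val_inj; rewrite /= -fx.
apply/andP; split.
  apply/forallP=> x; apply/forallP=> y; apply/implyP=> /prf.
  by rewrite !ffunE eq_s.
apply/forallP=> x; have [y dy] := domf x; apply/existsP.
exists (enum_rank (s y)); apply/andP; split.
  by apply/set0Pn; exists y; rewrite inE ffunE.
by apply/subsetP=> z; rewrite !inE ffunE eq_s => /eqP/dy.
Qed.

(** * Edges as two-element sets *)

Section Edges.

Variable G : sgraph.

Lemma is_edge_pair (x y : G) : adj x y -> is_edge [set x; y].
Proof.
by move=> xy; apply/existsP; exists x; apply/existsP; exists y; rewrite xy eqxx.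
Qed.

Lemma edgeP (A : edge G) : exists x y : G, adj x y /\ val A = [set x; y].
Proof.
case: A => A /= /existsP[x /existsP[y /andP[xy /eqP ->]]].
by exists x, y.
Qed.

Lemma adj_neq (x y : G) : adj x y -> x != y.
Proof. by apply: contraTneq => ->; rewrite adj_irrefl. Qed.

Lemma card_edge (A : edge G) : #|val A| = 2.
Proof. by have [x [y [xy ->]]] := edgeP A; rewrite cards2 adj_neq. Qed.

Lemma edge_other (A : edge G) (u : G) : exists2 p, p \in val A & p != u.
Proof.
have [x [y [xy ->]]] := edgeP A; have [<-|xu] := eqVneq x u.
  by exists y; rewrite ?set22 // eq_sym adj_neq.
by exists x; rewrite ?set21.
Qed.

End Edges.

Definition universal (G : sgraph) : {set G} :=
  [set x : G | [forall y : G, (y != x) ==> adj x y]].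

(** * Colourings of central graphs with few colours *)

Section UpperBounds.

Variable G : sgraph.
Local Notation U := (universal G).

Lemma universal_adj (x y : G) : x \in U -> y != x -> adj x y.
Proof. by rewrite inE => /forallP/(_ y)/implyP. Qed.

Lemma non_universal (x : G) :
  x \notin U -> exists y : G, [/\ y != x, ~~ adj x y & y \notin U].
Proof.
rewrite inE => /forallPn[y]; rewrite negb_imply => /andP[yx nxy].
exists y; split=> //; apply: contra nxy => yU.
by rewrite adj_sym universal_adj // eq_sym.
Qed.

(** Every vertex of [G] forms a class and all edges share [None]; each vertex has a non-neighbour,
    hence a singleton class adjacent to it. *)
Lemma tdc_central_universal0 :
  U = set0 -> tdc_number (central_graph G) <= #|G|.+1.
Proof.
move=> U0; rewrite -card_option.
apply: (tdc_number_leq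
  (f := fun p : central_graph G => if p is inl x then Some x else None)).
  by move=> [x|A] [y|B] //= /andP[xy _].
move=> [x|A].
  have [|y [yx nxy _]] := @non_universal x; first by rewrite U0 inE.
  by exists (inl y) => -[z|B] //= [->]; rewrite eq_sym yx.
have [x [y [xy defA]]] := edgeP A.
by exists (inl x) => -[z|B] //= [->]; rewrite defA set21.
Qed.

(* The universal vertex [u] is independent of the edges avoiding it, so they can
   share its colour; the edges at [u] form the extra class, dominated by [u]. *)
Lemma tdc_central_universal1 (u : G) :
  1 < #|G| -> U = [set u] -> tdc_number (central_graph G) <= #|G|.+1.
Proof.
move=> G2 U1; rewrite -card_option.
have uU : u \in U by rewrite U1 set11.
apply: (tdc_number_leq (f := fun p : central_graph G =>
  match p with
  | inl x => Some x
  | inr A => if u \in val A then None else Some u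
  end)).
  move=> [x|A] [y|B] //=; first by case/andP.
    move=> xB; case: ifPn => // uB.
    by apply: contraNneq uB => -[<-].
  move=> yA; case: ifPn => // uA.
  by apply: contraNneq uA => -[->].
have single (w : G) : w != u -> forall z : central_graph G,
    match z with
    | inl x => Some x
    | inr A => if u \in val A then None else Some u
    end = Some w -> z = inl w.
  move=> wu [x [->] //|A]; case: ifP => // _ [uw].
  by rewrite uw eqxx in wu.
move=> [x|A]; last first.
  have [p pA pu] := edge_other A u.
  by exists (inl p) => z /(single _ pu) ->.
have [->|xu] := eqVneq x u; last first.
  have [|y [yx nxy yU]] := @non_universal x; first by rewrite U1 inE.
  have yu : y != u by move: yU; rewrite U1 inE.
  by exists (inl y) => z /(single _ yu) -> /=; rewrite eq_sym yx.
have [y yu] : exists y : G, y != u.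
  have /set0Pn[y] : [set~ u] != set0.
    by rewrite -card_gt0 cardsC1; lia.
  by rewrite !inE => yu; exists y.
exists (inr (Sub [set u; y] (is_edge_pair (universal_adj uU yu)))) => z /=.
by rewrite set21; case: z => [//|B]; case: ifP.
Qed.

Lemma tdc_central_universal2 :
  2 <= #|U| -> tdc_number (central_graph G) <= #|G| + uphalf #|U|.
Proof.
set m := #|U| => m2.
have [x0 x0U] : exists x, x \in U by apply/set0Pn; rewrite -card_gt0; lia.
pose u i := nth x0 (enum U) i.
have sz : size (enum U) = m by rewrite -cardE.
have uU i : i < m -> u i \in U by move=> im; rewrite -mem_enum mem_nth ?sz.
have u_eq i j : i < m -> j < m -> (u i == u j) = (i == j).
  by move=> im jm; rewrite nth_uniq ?sz ?enum_uniq.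
pose x := u 0; pose y := u 1.
have xU : x \in U by apply: uU; lia.
have yU : y \in U by apply: uU; lia.
have xy : x != y by rewrite u_eq; lia.
(* The index wraps around so that for odd [m] the last vertex meets [u 0]. *)
pose e (i : 'I_(uphalf m)) := [set u i.*2; u (i.*2.+1 %% m)].
pose vcol v : G := if v == y then x else v.
have vcol_y v : vcol v != y by rewrite /vcol; case: (eqVneq v y).
(* Merging [y] into the class of [x] frees the colour [inl y], which takes all edges outside the
   cover. *)
pose col (p : central_graph G) : G + 'I_(uphalf m) :=
  match p with
  | inl v => inl (vcol v)
  | inr A => if [pick i | val A == e i] is Some i then inr i else inl y
  end.
have -> : #|G| + uphalf m = #|{: G + 'I_(uphalf m)}| by rewrite card_sum card_ord.
have col_inl (v : G) (z : central_graph G) :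
    col z = inl (vcol v) -> exists2 w, z = inl w & vcol w = vcol v.
  case: z => [w [ew]|A] /=; first by exists w.
  case: pickP => // _ [ey]; have := vcol_y v.
  by rewrite -ey eqxx.
have single v z : v != x -> v != y -> col z = inl (vcol v) -> z = inl v.
  move=> vx vy /col_inl[w ->]; rewrite /vcol (negPf vy).
  by case: (eqVneq w y) => [_ xv|_ -> //]; rewrite xv eqxx in vx.
apply: (tdc_number_leq (f := col)).
  move=> p q pq; apply: contraTneq pq.
  case: p => [v|A] => [/esym /col_inl|].
    case=> w -> /=; rewrite /vcol.
    case: (eqVneq w y) => [->|wy]; case: (eqVneq v y) => [->|vy].
    - by [].
    - by move<-; rewrite /= negbK universal_adj // eq_sym.
    - by move->; rewrite negb_and negbK universal_adj ?orbT.
    - by move->; rewrite eqxx.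
  by case: q => [v /col_inl[w]|B] //.
move=> [v|A].
  have [vU|/non_universal[w [wv nvw wU]]] := boolP (v \in U); last first.
    have wx : w != x by apply: contraNneq wU => ->.
    have wy : w != y by apply: contraNneq wU => ->.
    by exists (inl w) => z /(single _ _ wx wy) -> /=; rewrite eq_sym wv.
  have [j jm vE] : exists2 j, j < m & v = u j.
    exists (index v (enum U)); first by rewrite -sz index_mem mem_enum.
    by rewrite /u nth_index ?mem_enum.
  have jh : j./2 < uphalf m by lia.
  pose i := Ordinal jh.
  have vi : v \in e i.
    rewrite !inE vE; have [jo|je] := boolP (odd j).
      have -> : i.*2.+1 %% m = j by rewrite modn_small /=; lia.
      by rewrite eqxx orbT.
    have -> : i.*2 = j by rewrite /=; lia.
    by rewrite eqxx.
  have ei : is_edge (e i).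
    apply/is_edge_pair/universal_adj; first by apply: uU; rewrite /=; lia.
    have im : i.*2.+1 %% m < m by rewrite ltn_mod; lia.
    rewrite u_eq //; last by rewrite /=; lia.
    (* The index wraps only when [i.*2.+1 = m], and then to 0, which differs from [i.*2 = m.-1]
       since [2 <= m]. *)
    have [lt_im|] := ltnP i.*2.+1 m; first by rewrite modn_small //; lia.
    move=> ge_im; have -> : i.*2.+1 = m by rewrite /= in ge_im *; lia.
    by rewrite modnn /= in ge_im *; lia.
  exists (inr (Sub (e i) ei)) => z /=.
  case: pickP => [i' /eqP eii' |/(_ i)]; last by rewrite eqxx.
  case: z => //= B; case: pickP => // i2 /eqP eB [eqi].
  by rewrite eB eqi -eii'.
(* An edge has an endpoint that is a singleton class, or it joins [x] to [y] and is adjacent to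
   their common class. *)
have [/existsP[p /and3P[pA px py]]|/existsPn nA] :=
    boolP [exists p, [&& p \in val A, p != x & p != y]].
  by exists (inl p) => z /(single _ _ px py) ->.
have AE : val A = [set x; y].
  apply/eqP; rewrite eqEcard card_edge cards2 xy andbT.
  apply/subsetP=> p pA; have := nA p.
  by rewrite pA !inE /= negb_and !negbK.
exists (inl x) => z /col_inl[w ->] /=; rewrite AE !inE /vcol (negPf xy).
by case: (eqVneq w y) => [_|_ ->]; rewrite ?eqxx ?orbT.
Qed.

Lemma tdc_central_noncomplete (x y : G) :
    4 <= #|G| -> x != y -> ~~ adj x y ->
  tdc_number (central_graph G) < #|G| + uphalf #|G|.
Proof.
move=> G4 xy nxy.
have U_leq : #|U| + 2 <= #|G|.
  have sub : [set x; y] \subset ~: U.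
    apply/subsetP=> z; rewrite !inE => /orP[]/eqP->.
      by apply/forallPn; exists y; rewrite eq_sym xy.
    by apply/forallPn; exists x; rewrite xy adj_sym.
  by rewrite -(cardsC U) leq_add2l; move: (subset_leq_card sub); rewrite cards2 xy.
have [U2|U2] := leqP 2 #|U|.
  by apply: leq_ltn_trans (tdc_central_universal2 U2) _; lia.
suff : tdc_number (central_graph G) <= #|G|.+1 by lia.
have [U0|U_neq0] := eqVneq U set0; first exact: tdc_central_universal0.
have /cards1P[u U1] : #|U| == 1.
  by rewrite -card_gt0 in U_neq0; rewrite eqn_leq U_neq0 andbT -ltnS.
by apply: tdc_central_universal1 U1; lia.
Qed.

End UpperBounds.

(** * The exact value for complete graphs *)

Section Complete.

Variable G : sgraph.
Hypothesis adjE : forall x y : G, adj x y = (x != y).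

Lemma tdc_central_complete_leq :
  2 <= #|G| -> tdc_number (central_graph G) <= #|G| + uphalf #|G|.
Proof.
have cU : #|universal G| = #|G|.
  rewrite -cardsT; apply: eq_card => x; rewrite !inE.
  by apply/forallP=> y; rewrite adjE eq_sym implybb.
by move=> G2; rewrite -{2}cU tdc_central_universal2 ?cU.
Qed.

Definition pair_edge (x y : G) (xy : x != y) : edge G :=
  Sub [set x; y] (is_edge_pair (etrans (adjE x y) xy)).

Lemma has_tdc_central_complete k :
  4 <= #|G| -> has_tdc (central_graph G) k -> #|G| + uphalf #|G| <= k.
Proof.
set n := #|G| => n4 /existsP[f /andP[/andP[_ domf] /forallP surj]].
have dom (x : central_graph G) : exists i, (exists y, f y = i) /\
    (forall y, f y = i -> central_adj x y).
  have /existsP[i /andP[/set0Pn[y]]] := forallP domf x.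
  rewrite inE => /eqP fy /subsetP sub; exists i; split; first by exists y.
  by move=> z fz; have := sub z; rewrite !inE fz eqxx; apply.
pose g (x : G) := f (inl x).
pose D := [set g x | x : G].
have [c cP] := fin_all_exists (fun x : G => dom (inl x)).
have c_edge x : exists A, f (inr A) = c x.
  have [[[y|A] fy] cx] := cP x; last by exists A.
  by have /= := cx _ fy; rewrite adjE; case: (x == y).
have c_mem x (A : edge G) : f (inr A) = c x -> x \in val A.
  by have [_ cx] := cP x => /cx.
have c_notin x : c x \in ~: D.
  rewrite inE; apply/imsetP=> -[y _ cy]; have [_ cx] := cP x.
  by have /= := cx (inl y) (esym cy); rewrite adjE; case: (x == y).
(* The vertices that chose colour [i] are ends of every edge coloured [i]. *)
pose fib i := [set x : G | c x == i].
have fib_sub A : fib (f (inr A)) \subset val A.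
  by apply/subsetP=> x; rewrite inE => /eqP cx; apply: c_mem.
have fib_leq2 i : #|fib i| <= 2.
  have [->|/set0Pn[x]] := eqVneq (fib i) set0; first by rewrite cards0.
  rewrite inE => /eqP <-; have [A <-] := c_edge x.
  by rewrite -(card_edge A) subset_leq_card.
have sum_fib : n = \sum_(i in ~: D) #|fib i|.
  rewrite /n -sum1_card (partition_big c (mem (~: D))) //=.
  by apply: eq_bigr => i _; rewrite sum1dep_card.
have kE : k = #|D| + #|~: D| by rewrite cardsC card_ord.
have sum_leq (S : {set _}) : \sum_(i in S) #|fib i| <= #|S| * 2.
  by rewrite -sum_nat_const; apply: leq_sum.
have [/injectiveP g_inj|/injectivePn[u [v uv guv]]] := boolP (injectiveb g).
  have : #|D| = n by rewrite card_imset.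
  by have := sum_leq (~: D); rewrite -sum_fib; lia.
(* The subdividing vertex of [xy] has only [x] and [y] as neighbours, so the class of one of them
   lies within this pair. *)
have pair_dom x y (xy : x != y) : exists i, [/\ i = g x \/ i = g y &
    forall z, f z = i -> z = inl x \/ z = inl y].
  have [i [[z fz] di]] := dom (inr (pair_edge xy)); exists i; split.
    have := di z fz; case: z fz => [z|//] <- /=.
    by rewrite !inE => /orP[]/eqP->; [left|right].
  move=> [w|B] /di //=.
  by rewrite !inE => /orP[]/eqP->; [left|right].
have class_uv z : f z = g u -> z = inl u \/ z = inl v.
  have [i [ii di]] := pair_dom _ _ uv.
  have -> : g u = i by case: ii => ->.
  exact: di.
(* On the edge [pu], the class of [u] is excluded because it contains [v]. *)
have class_other p : p != u -> p != v -> forall z, f z = g p -> z = inl p.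
  move=> pu pv; have [i [ii di]] := pair_dom _ _ pu.
  have ip : i = g p.
    case: ii => // iu; have [] := di (inl v); first by rewrite iu guv.
      by case=> vp; rewrite vp eqxx in pv.
    by case=> vu; rewrite vu eqxx in uv.
  move=> z fz; have [//|zu] : z = inl p \/ z = inl u by apply: di; rewrite ip.
  have : f (inl p) = g u by rewrite -/(g p) -fz zu.
  by case/class_uv => -[pE]; rewrite pE eqxx in pu pv.
have D_geq : n.-1 <= #|D|.
  rewrite /n -(cardsC1 u) -(card_in_imset (f := g)); last first.
    move=> p q; rewrite !inE => pu qu gpq.
    have [pv|pv] := eqVneq p v; last first.
      by have [] := class_other p pu pv (inl q) (esym gpq).
    have [qv|qv] := eqVneq q v; first by rewrite pv qv.
    by have [] := class_other q qu qv (inl p) gpq.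
  by apply/subset_leq_card/subsetP=> i /imsetP[p _ ->]; apply: imset_f.
have edge_col A : f (inr A) \in ~: D.
  rewrite inE; apply/imsetP=> -[p _ fA].
  have [pu|pu] := eqVneq p u; first by move: fA; rewrite pu => /class_uv[].
  have [pv|pv] := eqVneq p v; first by move: fA; rewrite pv -guv => /class_uv[].
  by have := class_other p pu pv _ fA.
suff : uphalf n < #|~: D| by lia.
rewrite ltnNge; apply/negP=> P_leq.
(* The fibres, of size at most 2, sum to [n], while [2 * uphalf n <= n + 1]: at most one fibre falls
   short, and it still has an element [w]. If none does, any [w] works. *)
have [w wP] : exists w, forall i, i \in ~: D -> i != c w -> #|fib i| = 2.
  have [/existsP[i0 /andP[i0D fi0]]|/existsPn nfib] :=
      boolP [exists i, (i \in ~: D) && (#|fib i| < 2)]; last first.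
    exists u => i iD _; have := nfib i; rewrite iD /= -leqNgt => fi.
    by apply/eqP; rewrite eqn_leq fib_leq2.
  have cD1 : #|~: D| = (#|~: D :\ i0|).+1 by rewrite (cardsD1 i0) i0D.
  have sum1 : n = #|fib i0| + \sum_(i in ~: D :\ i0) #|fib i|.
    by rewrite sum_fib (big_setD1 i0).
  have /set0Pn[w] : fib i0 != set0.
    by rewrite -card_gt0; have := sum_leq (~: D :\ i0); lia.
  rewrite inE => /eqP cw; exists w => i iD; rewrite cw => ii0.
  have iD1 : i \in ~: D :\ i0 by rewrite in_setD1 ii0.
  have cD2 : #|~: D :\ i0| = (#|~: D :\ i0 :\ i|).+1.
    by rewrite (cardsD1 i) iD1.
  have : n <= #|fib i0| + (#|fib i| + #|~: D :\ i0 :\ i| * 2).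
    by rewrite sum1 (big_setD1 i) //= !leq_add2l sum_leq.
  by have := fib_leq2 i; lia.
have /card_gt2P[p [q [r [[pW qW rW] [pq qr rp]]]]] : 2 < #|[set~ w]|.
  by rewrite cardsC1 -/n; lia.
have pr : p != r by rewrite eq_sym.
rewrite !inE in pW qW rW.
(* An edge avoiding [w] cannot have colour [c w], so both its ends chose its colour; [p] would then
   choose the colours of both [pq] and [pr], forcing these edges to coincide. *)
have full x y (xy : x != y) : x != w -> y != w ->
    fib (f (inr (pair_edge xy))) = [set x; y].
  move=> xw yw; apply/eqP.
  rewrite eqEcard fib_sub (card_edge (pair_edge xy)) wP ?edge_col //.
  apply/eqP=> /c_mem; rewrite !inE eq_sym (negPf xw) eq_sym.
  by rewrite (negPf yw).
have pqE := full _ _ pq pW qW; have prE := full _ _ pr pW rW.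
have /eqP cpq : c p == f (inr (pair_edge pq)).
  by have := set21 p q; rewrite -pqE inE.
have /eqP cpr : c p == f (inr (pair_edge pr)).
  by have := set21 p r; rewrite -prE inE.
have := set22 p q; rewrite -pqE -cpq cpr prE !inE.
by rewrite eq_sym (negPf pq) (negPf qr).
Qed.

End Complete.

Lemma graph_iso_completeP (G : sgraph) (n : nat) : #|G| = n ->
  graph_iso G (complete_graph n) <-> forall x y : G, adj x y = (x != y).
Proof.
move=> cardG; split=> [[h /bij_inj h_inj hE] x y|adjE].
  by rewrite -hE /= /complete_adj (inj_eq h_inj).
exists (fun x => cast_ord cardG (enum_rank x) : complete_graph n).
  exists (fun i => enum_val (cast_ord (esym cardG) i)) => x.
    by rewrite cast_ordK enum_rankK.
  by rewrite enum_valK cast_ordKV.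
move=> x y; rewrite /= /complete_adj adjE.
by rewrite (inj_eq (@cast_ord_inj _ _ cardG)) (inj_eq enum_rank_inj).
Qed.

Theorem theorem2p5 (G : sgraph) (n : nat) (cardG : #|G| = n) (n_ge4 : 4 <= n)
    (connG : connected G) :
  tdc_number (central_graph G) = n + uphalf n <->
  graph_iso G (complete_graph n).
Proof.
rewrite graph_iso_completeP // -cardG in n_ge4 *; split=> [tdcE x y|adjE].
  have [->|xy] := eqVneq x y; first exact: adj_irrefl.
  apply/negPn/negP=> nxy.
  by have := tdc_central_noncomplete n_ge4 xy nxy; rewrite tdcE ltnn.
have [|tdcG _] := @tdc_numberP (central_graph G).
  by apply: central_no_isolated; lia.
apply/eqP; rewrite eqn_leq tdc_central_complete_leq //; last by lia.
exact: has_tdc_central_complete.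
Qed.
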